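(* Let $A$ be an Artin algebra and $n\ge0$ an integer. Suppose that $A$ is $n$-syzygy-finite and $\operatorname{ed}(A\text{-mod})=n$. Then $\operatorname{ed}\Omega^{i}(A\text{-mod})=n-i$ for each $0\le i\le n$.
   Context: $A$ is $n$-syzygy-finite if $\Omega^n(A\text{-mod})$ is representation-finite, i.e. there are only finitely many isomorphism classes of indecomposable direct summands of modules in $\Omega^n(A\text{-mod})$. $\Omega^0(A\text{-mod})=A\text{-mod}$; for $k\ge1$, $\Omega^k(A\text{-mod})$ is the full subcategory of modules $K$ with an exact sequence $0\to K\to P^0\to\cdots\to P^{k-1}\to M\to0$, $P^j$ projective. For subcategories $\mathcal T_1,\mathcal T_2$, $\mathcal T_1\bullet\mathcal T_2:=\operatorname{add}\{X\mid\exists$ exact $0\to T_1\to X\to T_2\to0$, $T_i\in\mathcal T_i\}$; $[T]_0=\{0\}$, $[T]_1=\operatorname{add}(T)$, $[T]_n=[T]_1\bullet[T]_{n-1}$; $\operatorname{ed}\mathcal C=\inf\{n\ge0\mid\mathcal C\subseteq[T]_{n+1}$ for some module $T\}$. *)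

(* Defs.v *)
From HB Require Import structures.
From mathcomp Require Import all_boot all_order all_algebra.
Set Implicit Arguments. Unset Strict Implicit. Unset Printing Implicit Defensive.
Import GRing.Theory.
Local Open Scope ring_scope.

Definition is_ideal (R : comNzRingType) (I : R -> Prop) : Prop :=
  I 0 /\ (forall x y, I x -> I y -> I (x - y)) /\ (forall r x, I x -> I (r * x)).

Definition artinian (R : comNzRingType) : Prop :=
  forall I : nat -> R -> Prop,
    (forall k, is_ideal (I k)) ->
    (forall k x, I k.+1 x -> I k x) ->
    exists N, forall k, (N <= k)%N -> forall x, I k x <-> I N x.

Definition fin_gen (S : pzRingType) (M : lmodType S) : Prop :=
  exists s : seq M, forall x : M,
    exists c : 'I_(size s) -> S, x = \sum_(i < size s) c i *: s`_i.

Definition artin_algebra (R : comNzRingType) (A : algType R) : Prop :=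
  artinian R /\ fin_gen A.

Section Modules.
Variable A : pzRingType.

Definition zero_mod (X : lmodType A) : Prop := forall x : X, x = 0.

Definition mod_iso (X Y : lmodType A) : Prop :=
  exists f : {linear X -> Y}, bijective f.

Definition summand (X Y : lmodType A) : Prop :=
  exists (i : {linear X -> Y}) (p : {linear Y -> X}), cancel i p.

Definition dsum (X Y : lmodType A) : lmodType A := (X * Y)%type.

Definition indecomposable (X : lmodType A) : Prop :=
  ~ zero_mod X /\
  forall Y1 Y2 : lmodType A, mod_iso X (dsum Y1 Y2) -> zero_mod Y1 \/ zero_mod Y2.

Definition short_exact (X Y Z : lmodType A) (f : {linear X -> Y})
  (g : {linear Y -> Z}) : Prop :=
  injective f /\ (forall z, exists y, g y = z) /\
  (forall y, g y = 0 <-> exists x, f x = y).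

Definition projective (P : lmodType A) : Prop :=
  fin_gen P /\
  forall (M N : lmodType A) (g : {linear M -> N}) (h : {linear P -> N}),
    (forall n, exists m, g m = n) ->
    exists h' : {linear P -> M}, forall p, g (h' p) = h p.

Definition subcat := lmodType A -> Prop.

Definition modcat : subcat := fun X => fin_gen X.

(* Omega^k(A-mod); K in Omega^{k+1} iff 0 -> K -> P -> L -> 0 exact with
   P projective and L in Omega^k (splicing of the long exact sequence). *)
Fixpoint Omega (k : nat) : subcat :=
  match k with
  | 0 => modcat
  | k'.+1 => fun K => fin_gen K /\
      exists (P L : lmodType A) (f : {linear K -> P}) (g : {linear P -> L}),
        projective P /\ Omega k' L /\ short_exact f g
  end.

Inductive addC (C : subcat) : subcat :=
  | addC_zero X : zero_mod X -> addC C X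
  | addC_obj X : C X -> addC C X
  | addC_sum X Y : addC C X -> addC C Y -> addC C (dsum X Y)
  | addC_summand X Y : addC C Y -> summand X Y -> addC C X.

Definition bullet (C1 C2 : subcat) : subcat :=
  addC (fun X => exists (T1 T2 : lmodType A) (f : {linear T1 -> X})
                        (g : {linear X -> T2}),
          C1 T1 /\ C2 T2 /\ short_exact f g).

Definition br1 (T : lmodType A) : subcat := addC (fun X => mod_iso X T).

Fixpoint br (T : lmodType A) (n : nat) : subcat :=
  match n with
  | 0 => zero_mod
  | n'.+1 => bullet (br1 T) (br T n')
  end.

Definition subcat_le (C D : subcat) : Prop := forall X, C X -> D X.

Definition ext_dim_eq (C : subcat) (d : nat) : Prop :=
  (exists T, fin_gen T /\ subcat_le C (br T d.+1)) /\
  (forall m, (m < d)%N -> ~ exists T, fin_gen T /\ subcat_le C (br T m.+1)).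

Definition rep_finite (C : subcat) : Prop :=
  exists (m : nat) (F : 'I_m -> lmodType A),
    forall X Y : lmodType A, C Y -> summand X Y -> indecomposable X ->
      exists i, mod_iso X (F i).

Definition syzygy_finite (n : nat) : Prop := rep_finite (Omega n).

End Modules.

(* Main.v *)
(* Everything reduces to the inequality ed Omega^i <= ed Omega^(i+1) + 1.  Since
   Omega^n is representation-finite, decomposition into indecomposables gives
   ed Omega^n = 0; hence ed Omega^i <= n - i, and ed Omega^i < n - i would force
   ed (A-mod) < n.

   For the inequality, let 0 -> K -> P -> X -> 0 be exact with P projective and K
   in [T]_(m+1).  By the horseshoe lemma there is an exact 0 -> K -> J -> C -> 0
   with J injective and C in [T']_(m+1), where T' is built from an injective
   envelope of T.  Pushing out along K -> J gives 0 -> P -> X + J -> C -> 0 (the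
   extension of X by J splits), so X lies in [A + T']_(m+2).

   Finitely generated injective envelopes exist because A is an Artin algebra.
   An artinian commutative ring R has a composition series, along which an
   essential extension of a module T of finite length has bounded length; an
   essential extension that cannot be enlarged is injective.  If E is such an
   envelope of T over R, then T embeds in the A-module Hom_R(A, E). *)
Require Import Defs.
From HB Require Import structures.
From mathcomp Require Import all_boot all_order all_algebra.
From mathcomp Require Import boolp classical_sets functions.
(* [fraction] also exports an [addC]. *)
Require Import Defs.
Set Implicit Arguments. Unset Strict Implicit. Unset Printing Implicit Defensive.
Import GRing.Theory.
Local Open Scope ring_scope.

(** * Submodules and quotients *)

Definition submodule (S : pzRingType) (M : lmodType S) (N : M -> Prop) : Prop :=
  N 0 /\ forall a x y, N x -> N y -> N (a *: x + y).

Section Submodules.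
Variables (S : pzRingType) (M : lmodType S).
Implicit Types N : M -> Prop.

Lemma submodD N x y : submodule N -> N x -> N y -> N (x + y).
Proof. by move=> [_ NL] Nx Ny; rewrite -[x]scale1r; apply: NL. Qed.

Lemma submodZ N a x : submodule N -> N x -> N (a *: x).
Proof. by move=> [N0 NL] Nx; rewrite -[_ *: _]addr0; apply: NL. Qed.

Lemma submodN N x : submodule N -> N x -> N (- x).
Proof. by rewrite -scaleN1r; apply: submodZ. Qed.

Lemma submodB N x y : submodule N -> N x -> N y -> N (x - y).
Proof. by move=> sN Nx Ny; apply: submodD => //; apply: submodN. Qed.

Lemma submodBC N x y : submodule N -> N (x - y) -> N (y - x).
Proof. by move=> sN Nxy; rewrite -opprB; apply: submodN. Qed.

Lemma submod_trans N y x z :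
  submodule N -> N (x - y) -> N (y - z) -> N (x - z).
Proof. by move=> sN Nxy Nyz; rewrite -(subrKA y); apply: submodD. Qed.

Lemma submodDr N x y : submodule N -> N y -> N (x + y) -> N x.
Proof. by move=> sN Ny Nxy; rewrite -[x](addrK y); apply: submodB. Qed.

Lemma submod_zero : submodule (fun x : M => x = 0).
Proof. by split=> // a x y -> ->; rewrite scaler0 addr0. Qed.

Lemma submod_full : submodule (fun _ : M => True).
Proof. by []. Qed.

Lemma submod_add N a : submodule N -> submodule (fun x => exists r, N (x - r *: a)).
Proof.
move=> sN; split; first by exists 0; rewrite scale0r subr0; case: sN.
move=> b x y [r Nr] [t Nt]; exists (b * r + t).
rewrite scalerDl -scalerA opprD addrACA -scalerBr.
by case: sN => _; apply.
Qed.

(* Besides disjointness, the avoided set [D] can express an upper bound [U] on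
   the maximal submodule, by containing the complement of [U]. *)
Lemma max_submodule N (D : M -> Prop) : submodule N -> (forall x, N x -> ~ D x) ->
  exists N', [/\ submodule N', (forall x, N x -> N' x), (forall x, N' x -> ~ D x) &
    forall y, ~ N' y -> exists x r, D x /\ N' (x - r *: y)].
Proof.
move=> sN ND.
pose P (F : set M) := (forall x, ~ F x) \/
  [/\ submodule F, (forall x, N x -> F x) & (forall x, F x -> ~ D x)].
have [|F [PF Fmax]] := @Zorn_bigcup M P.
  move=> C CP Ctot.
  have [[F0 CF0 [x0 F0x0]]|none] := pselect (exists2 F, C F & exists x, F x); last first.
    by left=> x [F CF Fx]; apply: none; exists F => //; exists x.
  have good F x : C F -> F x ->
    [/\ submodule F, (forall x, N x -> F x) & (forall x, F x -> ~ D x)].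
    by move=> CF Fx; case: (CP F CF) => // /(_ x).
  right; split.
  - split; first by exists F0 => //; have [[]] := good F0 x0 CF0 F0x0.
    move=> a x y [F CF Fx] [G CG Gy].
    have [sF _ _] := good F x CF Fx; have [sG _ _] := good G y CG Gy.
    case: (Ctot F G CF CG) => FG.
      by exists G => //; apply: (proj2 sG) => //; apply: FG.
    by exists F => //; apply: (proj2 sF) => //; apply: FG.
  - by move=> x Nx; exists F0 => //; have [_ + _] := good F0 x0 CF0 F0x0; apply.
  - by move=> x [F CF Fx]; have [_ _] := good F x CF Fx; apply.
have [sF NF FD] : [/\ submodule F, (forall x, N x -> F x) & (forall x, F x -> ~ D x)].
  case: PF => // F0; exfalso; apply: (Fmax N); last by right.
  split; first by move=> x /F0.
  by move=> /(_ 0 (proj1 sN)); apply: F0.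
exists F; split => // y Fy; apply: contrapT => none.
pose G x := exists r, F (x - r *: y).
apply: (Fmax G).
  split; first by move=> x Fx; exists 0; rewrite scale0r subr0.
  by move=> /(_ y) GF; apply/Fy/GF; exists 1; rewrite scale1r subrr; case: sF.
right; split; first exact: submod_add.
  by move=> x /NF Fx; exists 0; rewrite scale0r subr0.
by move=> x [r Fr] Dx; apply: none; exists x, r.
Qed.

End Submodules.

(** * Linear maps given by functions and by relations *)

Section LinearRelations.
Variables (S : pzRingType) (M N : lmodType S).

Lemma linear_of (f : M -> N) :
  (forall a x y, f (a *: x + y) = a *: f x + f y) ->
  exists g : {linear M -> N}, forall x, g x = f x.
Proof.
move=> fL; pose fM := GRing.isLinear.Build _ _ _ _ f fL.
pose g : {linear M -> N} := HB.pack f fM.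
by exists g.
Qed.

(** Two values of [rho] at the same [x] differ by a value at 0, so uniqueness at 0 gives uniqueness
    everywhere. This form serves to define maps out of cokernels and inverses of bijections. *)
Lemma linear_of_rel (rho : M -> N -> Prop) :
  (forall x, exists y, rho x y) ->
  (forall y, rho 0 y -> y = 0) ->
  (forall a x y x' y', rho x y -> rho x' y' -> rho (a *: x + x') (a *: y + y')) ->
  exists g : {linear M -> N}, forall x y, rho x y <-> g x = y.
Proof.
move=> tot r0 rL; have [f fP] := choice tot.
have f_uniq x y : rho x y -> f x = y.
  move=> rxy; have := rL (-1) _ _ _ _ (fP x) rxy.
  by rewrite !scaleN1r addNr => /r0 /eqP; rewrite addrC subr_eq0 => /eqP.
have [|g gf] := @linear_of f.
  by move=> a x y; apply: f_uniq; apply: rL.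
exists g => x y; rewrite gf; split; first exact: f_uniq.
by move=> <-.
Qed.

End LinearRelations.

(** * Submodules and quotients as modules *)

Section ModuleConstructions.
Variables (S : pzRingType) (M : lmodType S) (N : M -> Prop).
Hypothesis sN : submodule N.

(** The closure proof is a parameter of the type, so that the module structure, which depends on it,
    can be attached to the type itself. *)
Definition submod_type (_ : submodule N) := {x : M | `[< N x >]}.
Notation K := (submod_type sN).
HB.instance Definition _ := Choice.on K.
HB.instance Definition _ := SubType.on K.

Lemma submod_type_closed : submod_closed (fun x : M => `[< N x >]).
Proof.
split; first by apply/asboolP; case: sN.
move=> a x y /asboolP Nx /asboolP Ny; apply/asboolP.
by case: sN => _; apply.
Qed.

HB.instance Definition _ := GRing.SubChoice_isSubLmodule.Build S M _ K
  (GRing.subsemimod_closed_submod submod_type_closed).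

Lemma ex_submodule : exists (L : lmodType S) (i : {linear L -> M}),
  injective i /\ forall x, N x <-> exists y, i y = x.
Proof.
exists K, (\val : {linear K -> M}); split; first exact: val_inj.
move=> x; split; last by move=> [y <-]; apply/asboolP/(valP y).
by move=> /asboolP Nx; exists (exist _ x Nx).
Qed.

(* The carrier consists of canonical representatives of the cosets of [N]. *)
Definition coset_rep (x : M) : M := choose (fun y => `[< N (y - x) >]) x.

Lemma coset_repP x : N (coset_rep x - x).
Proof.
apply/asboolP; apply: (@chooseP _ (fun y => `[< N (y - x) >])).
by apply/asboolP; rewrite subrr; case: sN.
Qed.

(** Congruent elements define the same coset predicate, and [choose] returns the same element
    whichever member of the coset is its default. *)
Lemma eq_coset_rep x y : N (x - y) -> coset_rep x = coset_rep y.
Proof.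
move=> Nxy; rewrite /coset_rep; have -> :
    (fun z => `[< N (z - x) >]) = (fun z => `[< N (z - y) >]).
  apply: funext => z; apply/asbool_equiv_eq; split=> Nz.
    exact: (submod_trans sN Nz).
  by apply: (submod_trans sN Nz); apply: submodBC.
by apply: choose_id; apply/asboolP => //; rewrite subrr; case: sN.
Qed.

Lemma coset_rep_id x : coset_rep (coset_rep x) == coset_rep x.
Proof. by apply/eqP/eq_coset_rep/coset_repP. Qed.

Definition quot_type (_ : submodule N) := {x : M | coset_rep x == x}.
Notation Q := (quot_type sN).
HB.instance Definition _ := Choice.on Q.
HB.instance Definition _ := SubType.on Q.

Definition quot_proj (x : M) : Q := exist _ (coset_rep x) (coset_rep_id x).

Lemma quot_proj_eq x y : quot_proj x = quot_proj y <-> N (x - y).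
Proof.
split=> [[] Exy|Nxy]; last by apply: val_inj; apply: eq_coset_rep.
apply: submod_trans (coset_repP y) => //; rewrite -Exy.
by apply: submodBC => //; apply: coset_repP.
Qed.

Lemma val_quotK (u : Q) : quot_proj (val u) = u.
Proof. by apply: val_inj => /=; apply/eqP; case: u. Qed.

Definition quot_add (u v : Q) := quot_proj (val u + val v).
Definition quot_opp (u : Q) := quot_proj (- val u).
Definition quot_scale a (u : Q) := quot_proj (a *: val u).

Lemma quot_addE x y : quot_add (quot_proj x) (quot_proj y) = quot_proj (x + y).
Proof.
apply/quot_proj_eq; rewrite opprD addrACA.
by apply: submodD => //; apply: coset_repP.
Qed.
Lemma quot_oppE x : quot_opp (quot_proj x) = quot_proj (- x).
Proof. by apply/quot_proj_eq; rewrite -opprD; apply: submodN; last exact: coset_repP. Qed.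
Lemma quot_scaleE a x : quot_scale a (quot_proj x) = quot_proj (a *: x).
Proof. by apply/quot_proj_eq; rewrite -scalerBr; apply: submodZ; last exact: coset_repP. Qed.

Lemma quot_addA : associative quot_add.
Proof.
by move=> u v w; rewrite -[u]val_quotK -[v]val_quotK -[w]val_quotK !quot_addE addrA.
Qed.
Lemma quot_addC : commutative quot_add.
Proof. by move=> u v; rewrite /quot_add addrC. Qed.
Lemma quot_add0 : left_id (quot_proj 0) quot_add.
Proof. by move=> u; rewrite -[u]val_quotK quot_addE add0r. Qed.
Lemma quot_addN : left_inverse (quot_proj 0) quot_opp quot_add.
Proof. by move=> u; rewrite -[u]val_quotK quot_oppE quot_addE addNr. Qed.

HB.instance Definition _ :=
  GRing.isZmodule.Build Q quot_addA quot_addC quot_add0 quot_addN.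

Lemma quot_scaleA a b (u : Q) : quot_scale a (quot_scale b u) = quot_scale (a * b) u.
Proof. by rewrite -[u]val_quotK !quot_scaleE scalerA. Qed.
Lemma quot_scale1 : left_id 1 quot_scale.
Proof. by move=> u; rewrite /quot_scale scale1r val_quotK. Qed.
Lemma quot_scaleDr : right_distributive quot_scale +%R.
Proof.
move=> a u v; rewrite -[u]val_quotK -[v]val_quotK [_ + _]quot_addE.
by rewrite !quot_scaleE scalerDr [RHS]quot_addE.
Qed.
Lemma quot_scaleDl (u : Q) : {morph quot_scale^~ u : a b / a + b}.
Proof.
by move=> a b; rewrite -[u]val_quotK !quot_scaleE scalerDl [RHS]quot_addE.
Qed.

HB.instance Definition _ := GRing.Zmodule_isLmodule.Build S Q
  quot_scaleA quot_scale1 quot_scaleDr quot_scaleDl.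

Lemma ex_quotient : exists (L : lmodType S) (p : {linear M -> L}),
  (forall y, exists x, p x = y) /\ forall x, p x = 0 <-> N x.
Proof.
have [|p pE] := @linear_of S M Q quot_proj.
  move=> a x y; rewrite -[RHS]/(quot_add (quot_scale a _) _).
  by rewrite quot_scaleE quot_addE.
exists Q, p; split=> [y|x]; first by exists (val y); rewrite pE val_quotK.
by rewrite pE -[0]/(quot_proj 0) quot_proj_eq subr0.
Qed.

End ModuleConstructions.

(** * Length *)

(* The length of [N' / N] is at most [n]: [l] is a bounded monotone function that
   separates comparable submodules [T], [T'] differing on [N'] modulo [N]. *)
Definition length_le (S : pzRingType) (M : lmodType S) (N N' : M -> Prop) (n : nat) : Prop :=
  exists l : (M -> Prop) -> nat,
    (forall T, submodule T -> (l T <= n)%N) /\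
    forall T T', submodule T -> submodule T' -> (forall x, T x -> T' x) ->
      (l T <= l T')%N /\
      ((l T' <= l T)%N -> forall x, N' x -> T' x -> exists y, T y /\ N (x - y)).

Definition mod_length_le (S : pzRingType) (M : lmodType S) (n : nat) : Prop :=
  @length_le S M (fun x => x = 0) (fun _ => True) n.

(** The two functions are added. If the sum does not grow from [T] to [T'], neither summand does:
    [x] then agrees with some [y] in [T] modulo [N'], and the error [x - y], which lies in [N'] and
    [T'], agrees with some [z] in [T] modulo [N]. *)
Lemma length_le_trans (S : pzRingType) (M : lmodType S) (N N' N'' : M -> Prop) m n :
  length_le N N' m -> length_le N' N'' n -> length_le N N'' (m + n).
Proof.
move=> [l1 [b1 l1P]] [l2 [b2 l2P]]; exists (fun T => l1 T + l2 T)%N; split.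
  by move=> T sT; rewrite leq_add ?b1 ?b2.
move=> T T' sT sT' TT'.
have [m1 s1] := l1P _ _ sT sT' TT'; have [m2 s2] := l2P _ _ sT sT' TT'.
split=> [|le12 x Nx T'x]; first exact: leq_add.
have le1 : (l1 T' <= l1 T)%N.
  by rewrite -(leq_add2r (l2 T)); apply: leq_trans le12; rewrite leq_add2l.
have le2 : (l2 T' <= l2 T)%N.
  by rewrite -(leq_add2l (l1 T)); apply: leq_trans le12; rewrite leq_add2r.
have [y [Ty N'y]] := s2 le2 x Nx T'x.
have [|z [Tz Nz]] := s1 le1 (x - y) N'y; first by apply: submodB => //; apply: TT'.
by exists (y + z); split; [apply: submodD | rewrite opprD addrA].
Qed.

(** The function [l] on submodules of [Q] is evaluated at the image of [T] under [rho]. A relation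
    covers maps defined only on [N'], inverses of surjections and changes of the base ring in one
    statement. *)
Lemma length_le_rel (S S' : pzRingType) (M : lmodType S) (Q : lmodType S')
    (N N' : M -> Prop) (rho : M -> Q -> Prop) n :
  (forall T, submodule T -> submodule (fun q => exists x, T x /\ rho x q)) ->
  (forall x, N' x -> exists q, rho x q) ->
  (forall x y q, rho x q -> rho y q -> N (x - y)) ->
  mod_length_le Q n -> length_le N N' n.
Proof.
move=> sub tot ker [l [b lP]].
exists (fun T => l (fun q => exists x, T x /\ rho x q)); split.
  by move=> T sT; apply/b/sub.
move=> T T' sT sT' TT'; have [|le1 le2] := lP _ _ (sub _ sT) (sub _ sT').
  by move=> q [x [Tx rx]]; exists x; split => //; apply: TT'.
split=> // /le2 s2 x N'x T'x; have [q rq] := tot x N'x.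
have [//||q' [[y [Ty ry]] /eqP]] := s2 q; first by exists x.
rewrite subr_eq0 => /eqP Eq; exists y; split => //.
by apply: ker ry; rewrite -Eq.
Qed.

Section Length.
Variable S : pzRingType.
Implicit Types M N : lmodType S.

Lemma mod_length_le_inj M N (f : {linear M -> N}) n :
  injective f -> mod_length_le N n -> mod_length_le M n.
Proof.
move=> inj; apply: (length_le_rel (rho := fun x y => f x = y)).
- move=> T [T0 TL]; split; first by exists 0; rewrite linear0.
  by move=> a _ _ [x [Tx <-]] [y [Ty <-]]; exists (a *: x + y); rewrite linearP; split=> //; apply: TL.
- by move=> x _; exists (f x).
by move=> x y q <- /inj <-; rewrite subrr.
Qed.

(** If [l] were at least as large on the image of some [T] as on all of [N], that image would be all
    of [N]. Hence [l] stays below [n] on images. *)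
Lemma mod_length_le_proper M N (f : {linear M -> N}) n :
  injective f -> ~ (forall y, exists x, f x = y) -> mod_length_le N n ->
  (0 < n)%N /\ mod_length_le M n.-1.
Proof.
move=> inj nsurj [l [b lP]].
pose im T y := exists x, T x /\ f x = y.
have sim T : submodule T -> submodule (im T).
  move=> [T0 TL]; split; first by exists 0; rewrite linear0.
  by move=> a _ _ [x [Tx <-]] [y [Ty <-]]; exists (a *: x + y); rewrite linearP; split=> //; apply: TL.
have lt T : submodule T -> (l (im T) < n)%N.
  move=> sT; apply: (@leq_trans (l (fun _ => True))); last exact: b.
  rewrite ltnNge; apply/negP => le.
  have [_ /(_ le) s] := lP _ _ (sim _ sT) (@submod_full _ N) (fun _ _ => I).
  apply: nsurj => y; have [_ [[x [_ <-]] /eqP]] := s y I I.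
  by rewrite subr_eq0 => /eqP ->; exists x.
have n0 : (0 < n)%N.
  by apply: leq_ltn_trans (lt _ (@submod_full _ M)).
split=> //; exists (fun T => l (im T)); split.
  by move=> T sT; rewrite -ltnS prednK // lt.
move=> T T' sT sT' TT'; have [|le1 le2] := lP _ _ (sim _ sT) (sim _ sT').
  by move=> _ [x [Tx <-]]; exists x; split=> //; apply: TT'.
split=> // /le2 s2 x _ T'x.
have [//||_ [[y [Ty <-]] /eqP]] := s2 (f x); first by exists x.
by rewrite -linearB -(linear0 f) => /eqP /inj Exy; exists y.
Qed.

Fixpoint lin_span M (s : seq M) (x : M) : Prop :=
  if s is y :: s' then exists r, lin_span s' (x - r *: y) else x = 0.

Lemma submod_lin_span M (s : seq M) : submodule (lin_span s).
Proof.
by elim: s => [|y s IHs] /=; [apply: submod_zero | apply: submod_add].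
Qed.

Lemma lin_spanP M (s : seq M) x :
  lin_span s x <-> exists c : 'I_(size s) -> S, x = \sum_(i < size s) c i *: s`_i.
Proof.
elim: s x => [|y s IHs] x /=.
  split=> [->|[c ->]]; last by rewrite big_ord0.
  by exists (fun=> 0); rewrite big_ord0.
split=> [[r /IHs [c Ex]]|[c ->]].
  exists (fun i => if unlift ord0 i is Some j then c j else r).
  rewrite big_ord_recl unlift_none -[x](subrK (r *: y)) Ex addrC; congr (_ + _).
  by apply: eq_bigr => i _; rewrite liftK.
exists (c ord0); apply/IHs; exists (fun i => c (lift ord0 i)).
by rewrite big_ord_recl addrC addKr.
Qed.

Lemma fin_genP M : fin_gen M <-> exists s : seq M, forall x, lin_span s x.
Proof. by split=> -[s sP]; exists s => x; apply/lin_spanP. Qed.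

(** A finite list whose span has the largest value of [l] generates: adjoining any [x] does not
    raise [l], so [x] is already in the span. *)
Lemma mod_length_fin_gen M n : mod_length_le M n -> fin_gen M.
Proof.
move=> [l [b lP]].
pose P k := `[< exists s : seq M, l (lin_span s) = k >].
have [|k|k /asboolP [s sk] kmax] := @ex_maxnP P n.
- by exists (l (lin_span [::])); apply/asboolP; exists [::].
- by move=> /asboolP [s <-]; apply/b/submod_lin_span.
apply/fin_genP; exists s => x.
have sub y : lin_span s y -> lin_span (x :: s) y.
  by exists 0; rewrite scale0r subr0.
have [_ st] := lP _ _ (submod_lin_span s) (submod_lin_span (x :: s)) sub.
have [||y [sy /eqP]] := st _ x I.
- by rewrite sk; apply: kmax; apply/asboolP; exists (x :: s).
- by exists 1; rewrite scale1r subrr; case: (submod_lin_span s).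
by rewrite subr_eq0 => /eqP ->.
Qed.

Fixpoint image_span (B : lmodType S) M (s : seq {linear B -> M}) (x : M) : Prop :=
  if s is f :: s' then exists b, image_span s' (x - f b) else x = 0.

(** Each further map [f] enlarges the sum of the images by a quotient of [B], which adds at most [n]
    to the length. *)
Lemma mod_length_le_images (B : lmodType S) M (s : seq {linear B -> M}) n :
  (forall x, image_span s x) -> mod_length_le B n -> mod_length_le M (size s * n).
Proof.
move=> sM lB.
have [_] : submodule (image_span s) /\
    length_le (fun x => x = 0) (image_span s) (size s * n).
  elim: s {sM} => [|f s [IHs IHl]] /=.
    split; first exact: submod_zero.
    by exists (fun=> 0%N); split=> // T T' [T0 _] _ _; split=> // _ x -> _; exists 0; rewrite subrr.
  split.
    split; first by exists 0; rewrite linear0 subr0; case: IHs.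
    move=> a x y [b sb] [c sc]; exists (a *: b + c).
    by rewrite linearP opprD addrACA -scalerBr; apply: (proj2 IHs).
  rewrite mulSn addnC; apply: length_le_trans IHl _.
  (* This relation is the inverse of the surjection from [B] onto the new quotient, hence
     multivalued. *)
  apply: (length_le_rel (rho := fun x b => image_span s (x - f b))) lB => //.
    move=> T [T0 TL]; split; first by exists 0; rewrite linear0 subr0; case: IHs.
    move=> a b c [x [Tx sx]] [y [Ty sy]]; exists (a *: x + y); split; first exact: TL.
    by rewrite linearP opprD addrACA -scalerBr; apply: (proj2 IHs).
  move=> x y b sx sy; apply: (submod_trans IHs sx).
  exact: submodBC.
move=> [l [b lP]]; exists l; split=> // T T' sT sT' TT'.
have [le1 le2] := lP _ _ sT sT' TT'; split=> // /le2 s2 x _ T'x.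
exact: s2.
Qed.

Lemma fin_gen_length M n :
  mod_length_le (S^o : lmodType S) n -> fin_gen M -> exists m, mod_length_le M m.
Proof.
move=> lS /fin_genP [s sP].
have [|F FE] := @choice _ _ (fun (x : M) (f : {linear (S^o : lmodType S) -> M}) =>
    forall r : S, f r = r *: x).
  move=> x; apply: (@linear_of S (S^o : lmodType S) M (fun r : S => r *: x)) => a b c.
  by rewrite scalerDl scalerA.
exists (size (map F s) * n)%N; apply: mod_length_le_images lS => x.
move: (sP x); elim: s {sP} x => [|y s IHs] x //= [r sx].
by exists r; rewrite FE; apply: IHs.
Qed.

End Length.

(** * Injective envelopes over artinian commutative rings *)

Section ArtinianRings.
Variable R : comNzRingType.
Implicit Types I L : R -> Prop.

Notation ideal I := (@submodule R (R^o : lmodType R) I).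

Lemma is_ideal_submodule I : ideal I -> is_ideal I.
Proof.
move=> sI; split; first by case: sI.
by split=> [x y|r x]; [apply: (submodB sI) | apply: (submodZ _ sI)].
Qed.

(** Otherwise choosing a strictly smaller member again and again would give a descending chain that
    never becomes stationary. *)
Lemma artinian_minimal (P : (R -> Prop) -> Prop) I0 :
  artinian R -> (forall I, P I -> ideal I) -> P I0 ->
  exists I, P I /\ forall L, P L -> (forall x, L x -> I x) -> forall x, I x -> L x.
Proof.
move=> art Pid PI0; apply: contrapT => nomin.
have [|next nextP] := @choice {I | P I} {I | P I} (fun U V =>
    (forall x, sval V x -> sval U x) /\ ~ (forall x, sval U x -> sval V x)).
  move=> [I PI] /=; apply: contrapT => noL; apply: nomin; exists I; split=> //.
  move=> L PL LI; apply: contrapT => nIL; apply: noL.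
  by exists (exist _ L PL).
pose C k := iter k next (exist _ I0 PI0).
have [|k|N CN] := art (fun k => sval (C k)).
- by move=> k; apply/is_ideal_submodule/Pid/(svalP (C k)).
- by have [+ _] := nextP (C k).
have [_] := nextP (C N); apply => x CNx.
by apply/(CN N.+1 (leqnSn N)).
Qed.

(* [cofinite I] says that [R / I] has a composition series: in the last step the
   annihilator of [a] modulo [I'] is the unit ideal or a maximal ideal. *)
Inductive cofinite : (R -> Prop) -> Prop :=
| cofinite_full : cofinite (fun _ => True)
| cofinite_step I I' a : cofinite I -> ideal I' -> (forall x, I' x -> I x) ->
    (forall r, I' (r * a) \/ exists r', I' (a - r' * (r * a))) ->
    (forall x, I x -> exists r, I' (x - r * a)) -> cofinite I'.

Lemma cofinite_ideal I : cofinite I -> ideal I.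
Proof. by case. Qed.

(** A minimal cofinite ideal [I] is shown to be 0. If not, take [L] minimal with [L I] nonzero and
    [y] in [L] with [y I] nonzero. Minimality of [L] makes [R / Ann(y I)] a field, so [y I] is a
    vector space over it, and the preimage in [I] of a hyperplane of [y I] is a cofinite ideal
    strictly below [I]. *)
Lemma artinian_cofinite0 : artinian R -> cofinite (fun x => x = 0).
Proof.
move=> art; have [//|||I [cI Imin]] := @artinian_minimal cofinite (fun _ => True).
- exact: cofinite_ideal.
- exact: cofinite_full.
suff I0 x : I x -> x = 0.
  suff <- : I = (fun x => x = 0) by [].
  apply/funext => x; apply/propext; split=> [/I0 //|->].
  by case: (cofinite_ideal cI).
move=> Ix; apply: contrapT => x0.
have sI := cofinite_ideal cI.
pose P L := ideal L /\ exists y i, [/\ L y, I i & y * i <> 0].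
have [//|||L [[sL [y [i [Ly Ii yi]]]] Lmin]] := @artinian_minimal P (fun _ => True).
- by move=> L [].
- by split=> //; exists 1, x; rewrite mul1r.
(* If [y r] does not kill [I], the ideal [R y r] inside [L] qualifies for the minimality of [L], so
   it contains [y]. Then [z] inverts [r] modulo [Ann(y I)]. *)
have y_unit r : (forall j, I j -> y * (r * j) = 0) \/ exists z, y = z * (y * r).
  have [all0|] := pselect (forall j, I j -> y * (r * j) = 0); first by left.
  move=> /existsNP [j /not_implyP [Ij yrj]]; right.
  have [|w [z ->]|z] := Lmin (fun w => exists z, w = z * (y * r)) _ _ y Ly.
  - split; last by exists (y * r), j; split=> //; [exists 1; rewrite mul1r | rewrite -mulrA].
    split; first by exists 0; rewrite mul0r.
    by move=> a _ _ [z1 ->] [z2 ->]; exists (a * z1 + z2); rewrite mulrDl -mulrA.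
  - by rewrite [y * r]mulrC mulrA; apply: (submodZ _ sL).
  - by move=> yz; exists z.
pose K w := I w /\ y * w = 0.
have sK : ideal K.
  split; first by split; [case: sI | rewrite mulr0].
  move=> a u v [Iu yu] [Iv yv]; split; first exact: (proj2 sI).
  by rewrite mulrDr mulrCA yu yv mulr0 addr0.
(* [I'] is maximal among the ideals between [K] and [I] that miss [i]: the preimage of a hyperplane
   missing [y i]. *)
have [|I' [sI' KI' avoid I'max]] := @max_submodule R (R^o : lmodType R) K (fun w => w = i \/ ~ I w) sK.
  by move=> w [Iw yw] [wi|//]; apply: yi; rewrite -wi.
have I'I w : I' w -> I w by move=> /avoid nw; apply: contrapT => nIw; apply: nw; right.
suff cI' : cofinite I' by apply: (avoid i); [exact: Imin cI' _ _ Ii | left].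
apply: (cofinite_step cI sI' I'I (a := i)) => [r|w Iw].
  have [yr0|[z yz]] := y_unit r; [left|right].
    by apply: KI'; split; [apply: (submodZ _ sI) | apply: yr0].
  exists z; apply: KI'; split; first by apply: (submodB sI) => //; do 2 apply: (submodZ _ sI).
  by rewrite mulrBr {1}yz !mulrA -[z * y]mulrC subrr.
(* For [w] in [I] outside [I'], maximality gives [r] with [i - r w] in [I']. This [r] cannot kill
   [y I], so it has an inverse [z], and [w] is congruent to [z i]. *)
have [I'w|nI'w] := pselect (I' w); first by exists 0; rewrite mul0r subr0.
have [v [r [vD I'vw]]] := I'max w nI'w.
have Iv : I v.
  by rewrite -[v](subrK (r * w : R^o)); apply: (submodD sI); [apply: I'I | apply: (submodZ _ sI)].
case: vD => // Evi; subst v.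
have [yr0|[z yz]] := y_unit r.
  exfalso; apply: (avoid i); last by left.
  apply: (submodDr sI' _ I'vw); apply: (submodN sI'); apply: KI'.
  by split; [apply: (submodZ _ sI) | apply: yr0].
exists z; have I'zrw : I' (w - z * (r * w)).
  apply: KI'; split; first by apply: (submodB sI) => //; do 2 apply: (submodZ _ sI).
  by rewrite mulrBr {1}yz !mulrA -[z * y]mulrC subrr.
apply: (submod_trans sI' I'zrw); apply: (submodBC sI').
by rewrite -mulrBr; apply: (submodZ _ sI').
Qed.

(** Each step contributes one: [out T] records whether the part of [T] inside [I] leaves [I']. If it
    does, it fills the simple factor [I / I']. *)
Lemma cofinite_length I : cofinite I ->
  exists n, @length_le R (R^o : lmodType R) I (fun _ => True) n.
Proof.
elim=> [|{}I I' a cI [n In] sI' I'I a_simple aI].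
  by exists 0%N, (fun=> 0%N); split=> // T T' [T0 _] _ _; split=> // _ x _ _; exists 0.
exists (1 + n)%N; apply: length_le_trans In.
pose out (T : R -> Prop) := `[< exists x, [/\ T x, I x & ~ I' x] >].
exists (fun T => out T : nat); split; first by move=> T _; case: (out T).
move=> T T' sT sT' TT'; split.
  rewrite /out; case: asboolP => // -[x [Tx Ix nI'x]].
  by rewrite asboolT //; exists x; split => //; apply: TT'.
move=> le x Ix T'x.
have [I'x|nI'x] := pselect (I' x); first by exists 0; split; [case: sT | rewrite subr0].
move: le; rewrite {1}/out asboolT /=; last by exists x.
rewrite lt0b => /asboolP [y [Ty Iy nI'y]].
have [r I'yr] := aI y Iy.
have [t I'xt] := aI x Ix.
case: (a_simple r) => [I'ra|[r' I'r']].
  by case: nI'y; rewrite -[y](subrK (r * a)); apply: (submodD sI').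
(* Modulo [I'], [x] is [t a], [a] is [r' r a], and [r a] is [y]. *)
exists (t * (r' * y)); split; first by do 2 apply: (submodZ _ sT).
apply: (submod_trans sI' I'xt); rewrite -mulrBr; apply: (submodZ _ sI').
apply: (submod_trans sI' I'r'); rewrite -mulrBr; apply: (submodZ _ sI').
exact: (submodBC sI').
Qed.

Lemma artinian_length : artinian R -> exists n, mod_length_le (R^o : lmodType R) n.
Proof. by move=> /artinian_cofinite0 /cofinite_length. Qed.

(** Every nonzero submodule of [M] meets the image of [T]; it suffices to test this on cyclic
    submodules. *)
Definition essential (T M : lmodType R) (e : {linear T -> M}) : Prop :=
  injective e /\ forall y, y <> 0 -> exists r t, t <> 0 /\ r *: y = e t.

(* If [I = R a + I'], multiplication by [a] embeds [Ann_M I' / Ann_M I] into [T]. *)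
Lemma essential_length I (T : lmodType R) m : cofinite I -> mod_length_le T m ->
  exists n, forall (M : lmodType R) (e : {linear T -> M}), essential e ->
  length_le (fun x => x = 0) (fun x : M => forall r, I r -> r *: x = 0) n.
Proof.
move=> cI lT; elim: cI => [|{}I I' a cI [n In] sI' I'I a_simple aI].
  exists 0%N => M e _; exists (fun=> 0%N); split=> // U U' [U0 _] _ _; split=> // _ x x0 _.
  by exists 0; split=> //; rewrite subr0 -[x]scale1r x0.
exists (n + m)%N => M e ess; apply: length_le_trans (In M e ess) _.
case: ess => einj ess.
apply: (length_le_rel (rho := fun x t =>
  (forall r, I' r -> r *: x = 0) /\ a *: x = e t)) lT.
- move=> U sU; split.
    exists 0; split; first by case: sU.
    by split=> [r _|]; rewrite scaler0 ?linear0.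
  move=> b t t' [x [Ux [x0 xt]]] [x' [Ux' [x'0 x't']]].
  exists (b *: x + x'); split; first exact: (proj2 sU).
  split=> [r I'r|]; last by rewrite linearP scalerDr scalerA mulrC -scalerA xt x't'.
  by rewrite scalerDr scalerA mulrC -scalerA x0 // x'0 // scaler0 addr0.
(* A nonzero [a x] has a nonzero multiple [r a x] in the image of [T]. Then [r a] is outside [I'],
   hence generates [a] modulo [I'], and [a x] itself lies in the image of [T]. *)
- move=> x x0; have [ax0|ax0] := pselect (a *: x = 0).
    by exists 0; rewrite linear0.
  have [r [t [t0 rt]]] := ess _ ax0.
  case: (a_simple r) => [/x0|[r' /x0]].
    by rewrite -scalerA rt -(linear0 e) => /einj.
  rewrite scalerBl -!scalerA rt => /eqP; rewrite subr_eq0 => /eqP ax.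
  by exists (r' *: t); split=> //; rewrite linearZ.
move=> x y t [x0 xt] [y0 yt] r Ir; have [s I's] := aI r Ir.
rewrite -[r](subrK (s * a)) scalerDl scalerBr x0 // y0 // subrr add0r.
by rewrite -scalerA scalerBr xt yt subrr scaler0.
Qed.

Lemma essential_comp (T M N : lmodType R) (e : {linear T -> M}) (f : {linear M -> N}) :
  essential e -> essential f -> essential (f \o e).
Proof.
move=> [einj ess] [finj fess]; split; first exact: inj_comp.
move=> y /fess [r [x [/ess [s [t [t0 st]]] rx]]]; exists (s * r), t; split=> //.
by rewrite -scalerA rx -linearZ st.
Qed.

(** The annihilator of the zero ideal in [M] is all of [M], so one [n] bounds the length of every
    essential extension of [T]. Enlarging properly [n + 1] times would exceed it. *)
Lemma max_essential (T : lmodType R) m : artinian R -> mod_length_le T m ->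
  exists (M : lmodType R) (e : {linear T -> M}) n,
  [/\ essential e, mod_length_le M n & forall (N : lmodType R) (f : {linear M -> N}),
    essential f -> forall y, exists x, f x = y].
Proof.
move=> /artinian_cofinite0 c0 lT; have [n Hn] := essential_length c0 lT.
have {}Hn (M : lmodType R) (e : {linear T -> M}) : essential e -> mod_length_le M n.
  move=> /Hn [l [b lP]]; exists l; split=> // U U' sU sU' UU'.
  have [le1 le2] := lP _ _ sU sU' UU'; split=> // /le2 s2 x _ U'x.
  by apply: s2 => // r ->; rewrite scale0r.
apply: contrapT => nomax.
have grow k : exists (M : lmodType R) (e : {linear T -> M}), essential e /\
    forall p, mod_length_le M p -> (k <= p)%N.
  elim: k => [|k [M [e [ess kM]]]].
    have [id_ idE] := @linear_of R T T id (fun _ _ _ => erefl).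
    exists T, id_; split=> //; split; first by move=> x y; rewrite !idE.
    by move=> y y0; exists 1, y; rewrite scale1r idE.
  apply: contrapT => nogrow; apply: nomax; exists M, e, n; split=> //.
    exact: Hn ess.
  move=> N f essf; apply: contrapT => nsurj; apply: nogrow.
  exists N, (f \o e); split; first exact: essential_comp.
  move=> p /(mod_length_le_proper (proj1 essf) nsurj) [p0 /kM].
  by rewrite -ltnS prednK.
have [M [e [ess /(_ n (Hn _ _ ess))]]] := grow n.+1.
by rewrite ltnn.
Qed.

(** * Injectivity of modules without proper essential extensions *)

Definition injective_module (S : pzRingType) (E : lmodType S) : Prop :=
  forall (K P : lmodType S) (i : {linear K -> P}) (u : {linear K -> E}),
    injective i -> exists v : {linear P -> E}, forall x, v (i x) = u x.

(* A submodule of [M * P] maximal among those containing the graph of [- u] and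
   meeting [M] trivially is the graph of an extension of [u]. *)
Lemma max_essential_injective (M : lmodType R) :
  (forall (N : lmodType R) (f : {linear M -> N}),
    essential f -> forall y, exists x, f x = y) -> injective_module M.
Proof.
move=> Mmax K P i u iinj.
pose G (w : (M * P)%type) := exists x, w = (- u x, i x).
have sG : submodule (G : (M * P)%type -> Prop).
  split; first by exists 0; rewrite !linear0 ?oppr0.
  move=> a _ _ [x ->] [y ->]; exists (a *: x + y).
  by rewrite !linearP; congr pair; rewrite opprD scalerN.
have [|N [sN GN avoid Nmax]] := @max_submodule _ _ G (fun w => w.2 = 0 /\ w.1 <> 0) sG.
  move=> _ [x ->] /= [/eqP]; rewrite -(linear0 i) => /eqP /iinj ->.
  by rewrite linear0 ?oppr0.
have [Q [p [psurj pker]]] := ex_quotient sN.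
(* [M] embeds in the quotient by [N] because [N] meets it trivially, and essentially because [N] is
   maximal. By hypothesis this embedding is onto. *)
have [|f fE] := @linear_of R M Q (fun x => p (x, 0)).
  by move=> a x y; rewrite -linearP; congr (p _); congr pair; rewrite /= scaler0 addr0.
have fsurj : forall y, exists x, f x = y.
  apply: Mmax; split.
    move=> x y; rewrite !fE => /eqP; rewrite -subr_eq0 -linearB => /eqP /pker Nxy.
    apply/eqP; rewrite -subr_eq0; apply/eqP; apply: contrapT => xy.
    by apply: (avoid _ Nxy); rewrite /= subrr.
  move=> y y0; have [w Ew] := psurj y.
  have [|[m q] [r [[/= -> m0] Nw]]] := Nmax w.
    by move=> /pker; rewrite Ew.
  exists r, m; split=> //; rewrite fE -Ew -linearZ.
  by apply/eqP; rewrite eq_sym -subr_eq0 -linearB; apply/eqP/pker.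
(* Since [f] is onto, each [(0, x)] is congruent modulo [N] to some [(m, 0)]; this [m] is the value
   of the extension at [x]. *)
have [|z Nz|a x m y m' Nxm Nym'|v vE] := @linear_of_rel R P M (fun x m => N (- m, x)).
- move=> x; have [m Em] := fsurj (p (0, x)); exists m.
  have -> : (- m, x) = (0, x) - (m, 0) :> (M * P)%type.
    by congr pair; rewrite /= ?sub0r ?subr0.
  by apply/pker; rewrite linearB -fE Em subrr.
- apply: contrapT => z0; apply: (avoid _ Nz); split=> //= /eqP.
  by rewrite oppr_eq0 => /eqP.
- have -> : (- (a *: m + m'), a *: x + y) = a *: (- m, x) + (- m', y) :> (M * P)%type.
    by congr pair; rewrite /= opprD scalerN.
  exact: (proj2 sN).
by exists v => x; apply/vE; apply: GN; exists x.
Qed.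

Lemma injective_envelope (T : lmodType R) m : artinian R -> mod_length_le T m ->
  exists (E : lmodType R) (e : {linear T -> E}) n,
  [/\ injective e, mod_length_le E n & injective_module E].
Proof.
move=> art /(max_essential art) [E [e [n [[einj _] lE Emax]]]].
by exists E, e, n; split=> //; apply: max_essential_injective.
Qed.

End ArtinianRings.

(** * Injective envelopes over Artin algebras *)

Section ScalarRestriction.
Variables (R : comNzRingType) (A : algType R) (X : lmodType A).

(** A separate name for the carrier of [X], on which the scaling by [R] is declared without touching
    the scaling by [A]. *)
Definition restr : Type := X.
HB.instance Definition _ := GRing.Zmodule.on restr.
Definition restr_scale (r : R) (x : restr) : restr := (r%:A : A) *: (x : X).

Lemma restr_scaleA r s x : restr_scale r (restr_scale s x) = restr_scale (r * s) x.
Proof. by rewrite /restr_scale scalerA -scalerAl mul1r scalerA. Qed.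
Lemma restr_scale1 : left_id 1 restr_scale.
Proof. by move=> x; rewrite /restr_scale !scale1r. Qed.
Lemma restr_scaleDr : right_distributive restr_scale +%R.
Proof. by move=> r x y; rewrite /restr_scale scalerDr. Qed.
Lemma restr_scaleDl x : {morph restr_scale^~ x : r s / r + s}.
Proof. by move=> r s; rewrite /restr_scale !scalerDl. Qed.

HB.instance Definition _ := GRing.Zmodule_isLmodule.Build R restr
  restr_scaleA restr_scale1 restr_scaleDr restr_scaleDl.

Lemma restrZ r (x : restr) : r *: x = (r%:A : A) *: (x : X) :> X.
Proof. by []. Qed.

End ScalarRestriction.

Section Coinduction.
Variables (R : comNzRingType) (A : algType R) (E : lmodType R).

Definition linear_fun (f : A -> E) : bool :=
  `[< forall r a b, f (r *: a + b) = r *: f a + f b >].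

(** The module [Hom_R(A, E)], coinduced from [E]. *)
Definition coind : Type := {f : A -> E | linear_fun f}.
HB.instance Definition _ := Choice.on coind.
HB.instance Definition _ := SubType.on coind.

Lemma linear_fun_closed : zmod_closed linear_fun.
Proof.
split; first by apply/asboolP => r a b; rewrite scaler0 addr0.
move=> f g /asboolP fL /asboolP gL; apply/asboolP => r a b.
by rewrite /= !fctE fL gL opprD addrACA scalerBr.
Qed.

HB.instance Definition _ := GRing.SubChoice_isSubZmodule.Build (A -> E) _ coind
  linear_fun_closed.

Definition coind_fun (f : coind) : A -> E := val f.

Lemma coind_linear (f : coind) r a b :
  coind_fun f (r *: a + b) = r *: coind_fun f a + coind_fun f b.
Proof. by move: r a b; apply/asboolP/(valP f). Qed.

Lemma coindD (f g : coind) a : coind_fun (f + g) a = coind_fun f a + coind_fun g a.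
Proof. by rewrite /coind_fun raddfD. Qed.

Lemma coind_additive (f : coind) a b :
  coind_fun f (a + b) = coind_fun f a + coind_fun f b.
Proof. by rewrite -[a]scale1r coind_linear !scale1r. Qed.

Lemma coind_fun0 (f : coind) : coind_fun f 0 = 0.
Proof.
by apply/eqP; rewrite -(inj_eq (addIr (coind_fun f 0))) -coind_additive !add0r.
Qed.

Lemma coind_funZ (f : coind) r a : coind_fun f (r *: a) = r *: coind_fun f a.
Proof. by rewrite -[r *: a]addr0 coind_linear coind_fun0 addr0. Qed.

Lemma coind_ext (f g : coind) : (forall a, coind_fun f a = coind_fun g a) -> f = g.
Proof. by move=> fg; apply/val_inj/funext. Qed.

Lemma coind_scale_subproof (a : A) (f : coind) : linear_fun (fun b => coind_fun f (b * a)).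
Proof. by apply/asboolP => r b c; rewrite mulrDl -scalerAl coind_linear. Qed.

(** Multiplying the argument on the right yields a left action: [a (b f)] sends [c] to
    [f (c a b)]. *)
Definition coind_scale (a : A) (f : coind) : coind :=
  exist (fun g => linear_fun g) _ (coind_scale_subproof a f).

Lemma coind_scaleA a b f : coind_scale a (coind_scale b f) = coind_scale (a * b) f.
Proof. by apply: coind_ext => c; rewrite /coind_fun /= mulrA. Qed.
Lemma coind_scale1 : left_id 1 coind_scale.
Proof. by move=> f; apply: coind_ext => c; rewrite {1}/coind_fun /= mulr1. Qed.
Lemma coind_scaleDr : right_distributive coind_scale +%R.
Proof. by move=> a f g; apply: coind_ext => c; rewrite coindD; apply: coindD. Qed.
Lemma coind_scaleDl f : {morph coind_scale^~ f : a b / a + b}.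
Proof.
move=> a b; apply: coind_ext => c.
by rewrite coindD /coind_fun /= -/(coind_fun f) mulrDr coind_additive.
Qed.

HB.instance Definition _ := GRing.Zmodule_isLmodule.Build A coind
  coind_scaleA coind_scale1 coind_scaleDr coind_scaleDl.

Lemma coindZ a (f : coind) b : coind_fun (a *: f) b = coind_fun f (b * a).
Proof. by []. Qed.

Lemma coind0 a : coind_fun 0 a = 0.
Proof. by rewrite /coind_fun raddf0. Qed.

Lemma coindB (f g : coind) a : coind_fun (f - g) a = coind_fun f a - coind_fun g a.
Proof. by rewrite /coind_fun raddfB. Qed.

(* One half of Frobenius reciprocity, [Hom_A(P, Hom_R(A, E)) = Hom_R(P, E)]. *)
Lemma coind_adjoint (P : lmodType A) (v : {linear restr P -> E}) :
  exists w : {linear P -> coind}, forall x a, coind_fun (w x) a = v (a *: x).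
Proof.
have lv (x : P) : linear_fun (fun a => v (a *: x)).
  apply/asboolP => r a b; rewrite scalerDl -linearP; congr (v _).
  by rewrite restrZ scalerA -scalerAl mul1r.
have [|w wE] := @linear_of A P coind (fun x => exist (fun g => linear_fun g) _ (lv x)).
  move=> a x y; apply: coind_ext => b; rewrite coindD coindZ /coind_fun /= -linearD.
  by congr (v _); rewrite scalerDr scalerA.
by exists w => x a; rewrite wE.
Qed.

(** An [A]-map [u] into [Hom_R(A, E)] is determined by the [R]-map [x => u x 1]. The latter extends
    along [i] because [E] is injective, and the adjoint of the extension extends [u]. *)
Lemma coind_injective : injective_module E -> injective_module (coind : lmodType A).
Proof.
move=> Einj K P i u iinj.
have [|i' i'E] := @linear_of R (restr K) (restr P) i.
  by move=> r x y; rewrite !restrZ linearP.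
have [|u' u'E] := @linear_of R (restr K) E (fun x => coind_fun (u x) 1).
  move=> r x y; rewrite restrZ linearP coindD coindZ mul1r.
  by rewrite -coind_funZ.
have [|v vi] := Einj _ _ i' u'.
  by move=> x y; rewrite !i'E => /iinj.
have [w wE] := coind_adjoint v; exists w => x; apply: coind_ext => a.
by rewrite wE -linearZ -[X in v X]i'E vi u'E linearZ coindZ mul1r.
Qed.

(** Filter by the submodules [N s'] of maps vanishing on an initial stretch of generators.
    Evaluation at the next generator embeds each factor in [E], and a map vanishing on all
    generators is 0. *)
Lemma coind_length n :
  fin_gen (A : lmodType R) -> mod_length_le E n ->
  exists m, mod_length_le (coind : lmodType A) m.
Proof.
move=> /fin_genP [s sP] lE; exists (size s * n)%N.
pose N (s' : seq A) (f : coind) := forall a, a \in s' -> coind_fun f a = 0.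
have [l [b lP]] : @length_le A (coind : lmodType A) (N s) (fun _ => True) (size s * n).
  elim: s {sP} => [|a s IHs].
    exists (fun=> 0%N); split=> // T T' [T0 _] _ _; split=> // _ f _ _.
    by exists 0; split.
  rewrite mulSn; apply: (length_le_trans (N' := N s)) IHs.
  apply: (length_le_rel (rho := fun f e => N s f /\ coind_fun f a = e)) lE.
  - move=> T sT; split.
      exists 0; split; first by case: sT.
      by split=> [c _|]; rewrite coind0.
    move=> r e e' [f [Tf [Nf fe]]] [f' [Tf' [Nf' fe']]].
    have rE c : coind_fun (r%:A *: f + f') c = r *: coind_fun f c + coind_fun f' c.
      by rewrite coindD coindZ -scalerAr mulr1 coind_funZ.
    exists (r%:A *: f + f'); split; first exact: (proj2 sT).
    by split=> [c sc|]; rewrite rE ?fe ?fe' // Nf // Nf' // scaler0 addr0.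
  - by move=> f Nf; exists (coind_fun f a).
  move=> f g e [Nf fe] [Ng ge] c; rewrite inE coindB => /orP [/eqP ->|sc].
    by rewrite fe ge subrr.
  by rewrite Nf // Ng // subrr.
exists l; split=> // T T' sT sT' TT'.
have [le1 le2] := lP _ _ sT sT' TT'; split=> // /le2 s2 f _ T'f.
have [g [Tg Nfg]] := s2 f I T'f; exists g; split=> //.
apply: coind_ext => c; rewrite coind0.
have vanish s' : forall d, lin_span s' d -> N s' (f - g) -> coind_fun (f - g) d = 0.
  elim: s' => [|a s' IHs] d /=; first by move=> -> _; apply: coind_fun0.
  move=> [r sd] Nfg'; rewrite -[d](subrK (r *: a)) coind_additive coind_funZ.
  rewrite (Nfg' a) ?mem_head // scaler0 addr0; apply: IHs => // a' sa'.
  by apply: Nfg'; rewrite inE sa' orbT.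
by apply: vanish (sP c) Nfg.
Qed.

End Coinduction.

Section ArtinAlgebras.
Variables (R : comNzRingType) (A : algType R).
Hypothesis artA : artin_algebra A.

Lemma artin_algebra_length : exists n, mod_length_le (A : lmodType R) n.
Proof.
by have [/artinian_length [n lR] fA] := artA; apply: fin_gen_length lR fA.
Qed.

(** Over [R], [X] is a finite sum of images of the maps [a => a *: x] from [A], which has finite
    length. *)
Lemma fin_gen_restr_length (X : lmodType A) :
  fin_gen X -> exists n, mod_length_le (restr X : lmodType R) n.
Proof.
have [n lA] := artin_algebra_length => /fin_genP [s sP].
have [|F FE] := @choice _ _ (fun (x : X) (f : {linear A -> restr X}) =>
    forall a : A, f a = a *: x).
  move=> x; apply: (@linear_of R A (restr X) (fun a : A => a *: x)) => r a b.
  by rewrite restrZ scalerDl scalerA -scalerAl mul1r.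
exists (size (map F s) * n)%N; apply: mod_length_le_images lA => x.
move: (sP x); elim: s {sP} x => [|y s IHs] x //= [a sx].
by exists a; rewrite FE; apply: IHs.
Qed.

(** Submodules over [A] are submodules over [R], so a length bound over [R] is one over [A]. *)
Lemma fin_gen_mod_length (X : lmodType A) : fin_gen X -> exists n, mod_length_le X n.
Proof.
move=> /fin_gen_restr_length [n lX]; exists n.
apply: (length_le_rel (rho := fun (x : X) (y : restr X) => x = y)) lX.
- move=> T [T0 TL]; split; first by exists 0.
  by move=> r _ _ [x [Tx <-]] [y [Ty <-]]; exists (r%:A *: x + y); split=> //; apply: TL.
- by move=> x _; exists x.
by move=> x y q -> ->; rewrite subrr.
Qed.

(** The embedding sends [x] to [a => e (a *: x)]; its value at 1 recovers [e x]. The injective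
    module obtained need not be an essential extension of [X]. *)
Lemma fin_gen_injective_envelope (X : lmodType A) : fin_gen X ->
  exists (J : lmodType A) (i : {linear X -> J}),
  [/\ injective i, injective_module J & fin_gen J].
Proof.
have [art fA] := artA.
move=> /fin_gen_restr_length [n /(injective_envelope art) [E [e [m [einj lE Einj]]]]].
have [i iE] := coind_adjoint e; exists (coind A E), i; split.
- by move=> x y Exy; apply: einj; rewrite -[x in LHS]scale1r -[y in RHS]scale1r -!iE Exy.
- exact: coind_injective.
by have [k /mod_length_fin_gen] := coind_length fA lE.
Qed.

End ArtinAlgebras.

(** * Extensions and cosyzygies *)

Section FinitelyGenerated.
Variable S : pzRingType.
Implicit Types X Y Z : lmodType S.

Lemma lin_span_map X Y (f : {linear X -> Y}) s x : lin_span s x -> lin_span (map f s) (f x).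
Proof.
elim: s x => [|y s IHs] x /= => [->|[r sx]]; first by rewrite linear0.
by exists r; rewrite -linearZ -linearB; apply: IHs.
Qed.

Lemma lin_span_cat X (s t : seq X) x y :
  lin_span s x -> lin_span t y -> lin_span (s ++ t) (x + y).
Proof.
elim: s x => [|z s IHs] x /= => [->|[r sx]] ty; first by rewrite add0r.
by exists r; rewrite addrAC; apply: IHs.
Qed.

Lemma ex_inl X Y : exists f : {linear X -> dsum X Y}, forall x, f x = (x, 0).
Proof. by apply: linear_of => a x y; congr pair; rewrite /= scaler0 addr0. Qed.

Lemma ex_inr X Y : exists f : {linear Y -> dsum X Y}, forall y, f y = (0, y).
Proof. by apply: linear_of => a x y; congr pair; rewrite /= scaler0 addr0. Qed.

Lemma ex_pair X Y Z (f : {linear Z -> X}) (g : {linear Z -> Y}) :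
  exists h : {linear Z -> dsum X Y}, forall z, h z = (f z, g z).
Proof. by apply: linear_of => a x y; rewrite !linearP. Qed.

Lemma ex_copair X Y Z (f : {linear X -> Z}) (g : {linear Y -> Z}) :
  exists h : {linear dsum X Y -> Z}, forall w, h w = f w.1 + g w.2.
Proof. by apply: linear_of => a x y; rewrite /= !linearP scalerDr addrACA. Qed.

Lemma fin_gen_surj X Y (f : {linear X -> Y}) :
  (forall y, exists x, f x = y) -> fin_gen X -> fin_gen Y.
Proof.
move=> surj /fin_genP [s sP]; apply/fin_genP; exists (map f s) => y.
by have [x <-] := surj y; apply: lin_span_map.
Qed.

Lemma fin_gen_dsum X Y : fin_gen X -> fin_gen Y -> fin_gen (dsum X Y).
Proof.
move=> /fin_genP [s sP] /fin_genP [t tP]; apply/fin_genP.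
have [i iE] := ex_inl X Y; have [j jE] := ex_inr X Y.
exists (map i s ++ map j t) => -[x y].
have -> : (x, y) = i x + j y by rewrite iE jE; congr pair; rewrite /= ?addr0 ?add0r.
by apply: lin_span_cat; apply: lin_span_map.
Qed.

Lemma zero_mod_fin_gen X : zero_mod X -> fin_gen X.
Proof. by move=> X0; apply/fin_genP; exists [::] => x; apply: X0. Qed.

Definition zero_module : lmodType S := 'rV[S]_0.

Lemma zero_moduleP : zero_mod zero_module.
Proof. by move=> x; apply: thinmx0. Qed.

Lemma ex_zero_map X Y : exists f : {linear X -> Y}, forall x, f x = 0.
Proof. by apply: linear_of => *; rewrite scaler0 addr0. Qed.

Lemma regular_fin_gen : fin_gen (S^o : lmodType S).
Proof.
apply/fin_genP; exists [:: 1] => x; exists x => /=.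
by rewrite [_ *: _]mulr1 subrr.
Qed.

Lemma projective_zero X : zero_mod X -> projective X.
Proof.
move=> X0; split; first exact: zero_mod_fin_gen.
move=> M N g h _; have [k kE] := ex_zero_map X M; exists k => x.
by rewrite kE (X0 x) !linear0.
Qed.

Lemma projective_regular : projective (S^o : lmodType S).
Proof.
split; first exact: regular_fin_gen.
move=> M N g h surj; have [m Em] := surj (h 1).
have [|k kE] := @linear_of S (S^o : lmodType S) M (fun a : S => a *: m).
  by move=> a x y; rewrite scalerDl scalerA.
exists k => a; rewrite kE linearZ Em -linearZ; congr (h _).
exact: mulr1.
Qed.

Lemma projective_dsum X Y : projective X -> projective Y -> projective (dsum X Y).
Proof.
move=> [fX pX] [fY pY]; split; first exact: fin_gen_dsum.
move=> M N g h surj; have [i iE] := ex_inl X Y; have [j jE] := ex_inr X Y.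
have [u uE] := pX _ _ g (h \o i) surj; have [v vE] := pY _ _ g (h \o j) surj.
have [w wE] := ex_copair u v; exists w => -[x y].
rewrite wE linearD uE vE /= -linearD iE jE; congr (h _).
by congr pair; rewrite /= ?addr0 ?add0r.
Qed.

Lemma injective_module_zero X : zero_mod X -> injective_module X.
Proof.
move=> X0 K P i u _; have [v vE] := ex_zero_map P X; exists v => x.
by rewrite [RHS]X0 [LHS]X0.
Qed.

Lemma injective_module_dsum X Y :
  injective_module X -> injective_module Y -> injective_module (dsum X Y).
Proof.
move=> iX iY K P i u iinj.
have [|p pE] := @linear_of S (dsum X Y) X fst; first by [].
have [|q qE] := @linear_of S (dsum X Y) Y snd; first by [].
have [v vE] := iX K P i (p \o u) iinj; have [w wE] := iY K P i (q \o u) iinj.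
have [h hE] := ex_pair v w; exists h => x.
by rewrite hE vE wE /= pE qE -surjective_pairing.
Qed.

End FinitelyGenerated.

Section Extensions.
Variable S : pzRingType.
Implicit Types X Y Z W K J C P T U : lmodType S.

Lemma summand_inl X Y : summand X (dsum X Y).
Proof.
have [i iE] := ex_inl X Y; exists i.
have [|p pE] := @linear_of S (dsum X Y) X fst; first by [].
by exists p => x; rewrite iE pE.
Qed.

Lemma summand_inr X Y : summand Y (dsum X Y).
Proof.
have [i iE] := ex_inr X Y; exists i.
have [|p pE] := @linear_of S (dsum X Y) Y snd; first by [].
by exists p => x; rewrite iE pE.
Qed.

Lemma summand_refl X : summand X X.
Proof.
have [i iE] := @linear_of S X X id (fun _ _ _ => erefl).
by exists i, i => x; rewrite !iE.
Qed.

Lemma summand_trans X Y Z : summand X Y -> summand Y Z -> summand X Z.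
Proof.
move=> [i [p pi]] [j [q qj]]; exists (j \o i), (p \o q) => x /=.
by rewrite qj pi.
Qed.

Lemma mod_iso_inv X Y : mod_iso X Y -> mod_iso Y X.
Proof.
move=> [f [g fK gK]].
have [|h hE] := @linear_of S Y X g.
  by move=> a x y; apply: (can_inj fK); rewrite linearP !gK.
by exists h, f => x; rewrite hE ?fK ?gK.
Qed.

Lemma mod_iso_summand X Y : mod_iso X Y -> summand X Y.
Proof.
move=> [f [g fK gK]].
have [|h hE] := @linear_of S Y X g.
  by move=> a x y; apply: (can_inj fK); rewrite linearP !gK.
by exists f, h => x; rewrite hE fK.
Qed.

Lemma short_exact_comp0 X Y Z (f : {linear X -> Y}) (g : {linear Y -> Z}) x :
  short_exact f g -> g (f x) = 0.
Proof. by move=> [_ [_ ex]]; apply/ex; exists x. Qed.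

Lemma short_exact_factor X Y Z W (f : {linear X -> Y}) (g : {linear Y -> Z})
    (h : {linear Y -> W}) : short_exact f g -> (forall x, h (f x) = 0) ->
  exists k : {linear Z -> W}, forall y, k (g y) = h y.
Proof.
move=> [_ [surj ex]] h0.
have [||a z w z' w' [y [gy hy]] [y' [gy' hy']]|k kE] :=
    @linear_of_rel S Z W (fun z w => exists y, g y = z /\ h y = w).
- by move=> z; have [y <-] := surj z; exists (h y), y.
- by move=> _ [y [/ex [x <-] <-]].
- by exists (a *: y + y'); rewrite !linearP gy gy' hy hy'.
by exists k => y; apply/kE; exists y.
Qed.

Lemma ex_cokernel X Y (f : {linear X -> Y}) : injective f ->
  exists (Z : lmodType S) (g : {linear Y -> Z}), short_exact f g.
Proof.
move=> finj; have [|Z [g [surj ker]]] := @ex_quotient S Y (fun y => exists x, f x = y).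
  split; first by exists 0; rewrite linear0.
  by move=> a _ _ [x <-] [y <-]; exists (a *: x + y); rewrite linearP.
by exists Z, g.
Qed.

(** A form of Schanuel's lemma. The maps [a] and [b] extend to [u : J -> J'] and [v : J' -> J],
    which induce [u1] and [v1] on cokernels. Since [v u - 1] vanishes on [K], it factors through
    some [s : C -> J], and [v1 u1 - g s] is the identity of [C]. *)
Lemma cosyzygy_summand K Y J C J' C' (f : {linear K -> J}) (g : {linear J -> C})
    (f' : {linear Y -> J'}) (g' : {linear J' -> C'}) :
  injective_module J -> injective_module J' -> short_exact f g -> short_exact f' g' ->
  summand K Y -> summand C (dsum C' J).
Proof.
move=> iJ iJ' ex ex' [a [b ab]].
have [u uE] := iJ' _ _ f (f' \o a) (proj1 ex).
have [v vE] := iJ _ _ f' (f \o b) (proj1 ex').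
have [|u1 u1E] := short_exact_factor (h := g' \o u) ex.
  by move=> x; rewrite /= uE; apply: short_exact_comp0 ex'.
have [|v1 v1E] := short_exact_factor (h := g \o v) ex'.
  by move=> x; rewrite /= vE; apply: short_exact_comp0 ex.
have [|d dE] := @linear_of S J J (fun x => v (u x) - x).
  by move=> r x y; rewrite !linearP addrACA -scalerDr.
have [|s sE] := short_exact_factor (h := d) ex.
  by move=> x; rewrite dE uE /= vE /= ab subrr.
have [i iE] := ex_pair u1 s.
have [|p pE] := @linear_of S (dsum C' J) C (fun w => v1 w.1 - g w.2).
  by move=> r x y; rewrite /= !linearP addrACA -scalerDr.
exists i, p => c; have [j <-] := proj1 (proj2 ex) c.
by rewrite iE pE /= u1E sE v1E dE /= linearB opprB addrC subrK.
Qed.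

(** Extend [i] along [f] to [h : P -> J], and let [t : X -> C] be the induced map. The sequence is
    given by [(g, h)] and [q - t]. *)
Lemma pushout_extension K P X J C (f : {linear K -> P}) (g : {linear P -> X})
    (i : {linear K -> J}) (q : {linear J -> C}) :
  injective_module J -> short_exact f g -> short_exact i q ->
  exists (f' : {linear P -> dsum X J}) (g' : {linear dsum X J -> C}), short_exact f' g'.
Proof.
move=> iJ ex ex'; have [h hE] := iJ _ _ f i (proj1 ex).
have [|t tE] := short_exact_factor (h := q \o h) ex.
  by move=> x; rewrite /= hE; apply: short_exact_comp0 ex'.
have [f' f'E] := ex_pair g h.
have [|g' g'E] := @linear_of S (dsum X J) C (fun w => q w.2 - t w.1).
  by move=> r x y; rewrite /= !linearP addrACA -scalerDr.
exists f', g'; case: (ex) => finj [gsurj exg]; case: (ex') => iinj [qsurj exq].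
split; last split.
- move=> x y /eqP; rewrite -subr_eq0 -linearB f'E => /eqP [/exg [k Ek]].
  rewrite -Ek hE -(linear0 i) => /iinj k0; apply/eqP.
  by rewrite -subr_eq0 -Ek k0 linear0.
- by move=> c; have [j <-] := qsurj c; exists (0, j); rewrite g'E /= linear0 subr0.
move=> [x j]; rewrite g'E /=; split=> [|[p]]; last first.
  by rewrite f'E => -[<- <-]; rewrite tE subrr.
have [p <-] := gsurj x; rewrite tE /= -linearB => /exq [k Ek].
exists (p + f k); rewrite f'E !linearD /= hE Ek (short_exact_comp0 _ ex) addr0.
by rewrite addrC subrK.
Qed.

(** The embedding of [K] is [(u, i2 g)], where [u] extends [i1] along [f]. The exact sequence of
    cokernels is then a diagram chase. *)
Lemma horseshoe X K Y J1 C1 J2 C2 (f : {linear X -> K}) (g : {linear K -> Y})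
    (i1 : {linear X -> J1}) (q1 : {linear J1 -> C1})
    (i2 : {linear Y -> J2}) (q2 : {linear J2 -> C2}) :
  injective_module J1 -> short_exact f g -> short_exact i1 q1 -> short_exact i2 q2 ->
  exists (C : lmodType S) (i : {linear K -> dsum J1 J2}) (q : {linear dsum J1 J2 -> C})
    (a : {linear C1 -> C}) (b : {linear C -> C2}), short_exact i q /\ short_exact a b.
Proof.
move=> iJ1 ex ex1 ex2; have [u uE] := iJ1 _ _ f i1 (proj1 ex).
have [i iE] := ex_pair u (i2 \o g).
case: (ex) (ex1) (ex2) => finj [gsurj exg] [i1inj [q1surj exq1]] [i2inj [q2surj exq2]].
have iinj : injective i.
  move=> x y /eqP; rewrite -subr_eq0 -linearB iE => /eqP [ux].
  rewrite -(linear0 i2) => /i2inj /exg [z Ez]; apply/eqP; rewrite -subr_eq0.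
  by move: ux; rewrite -Ez uE -(linear0 i1) => /i1inj ->; rewrite linear0.
have [C [q exC]] := ex_cokernel iinj; have [_ [qsurj exq]] := exC.
have [l lE] := ex_inl J1 J2.
have [|a aE] := short_exact_factor (h := q \o l) ex1.
  move=> x; apply/exq; exists (f x).
  by rewrite iE lE uE /= (short_exact_comp0 _ ex) linear0.
have [|r rE] := @linear_of S (dsum J1 J2) C2 (fun w => q2 w.2).
  by move=> c x y; rewrite linearP.
have [|b bE] := short_exact_factor (h := r) exC.
  by move=> k; rewrite rE iE; apply: short_exact_comp0 ex2.
exists C, i, q, a, b; split=> //; split; last split.
- move=> x y /eqP; rewrite -subr_eq0 -linearB => /eqP; set z := x - y => az.
  apply/eqP; rewrite -subr_eq0 -/z; have [j Ej] := q1surj z.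
  move: az; rewrite -Ej aE => /exq [k]; rewrite iE lE => -[uk /eqP].
  rewrite -(linear0 i2) => /eqP /i2inj /exg [t Et].
  by apply/eqP/exq1; exists t; rewrite -uE Et.
- by move=> c; have [j <-] := q2surj c; exists (q (0, j)); rewrite bE rE.
move=> c; split=> [|[x <-]]; last first.
  by have [j <-] := q1surj x; rewrite aE /= bE rE lE linear0.
have [[j1 j2] <-] := qsurj c; rewrite bE rE /= => /exq2 [t]; have [k <-] := gsurj t.
(* Subtracting [i k] from [(j1, j2)] does not change its class and clears the second coordinate. *)
move=> Ek; exists (q1 (j1 - u k)); rewrite aE /=.
apply/eqP; rewrite -subr_eq0 -linearB; apply/eqP/exq; exists (- k).
rewrite linearN iE lE /= Ek; congr pair; rewrite /= ?sub0r //.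
by rewrite addrAC subrr add0r.
Qed.

(** * Additive closures and the classes [[T]_n] *)

Lemma addC_bind (C D : subcat S) X : (forall Y, C Y -> addC D Y) -> addC C X -> addC D X.
Proof.
move=> CD; elim=> {}X; [exact: addC_zero | exact: CD | |].
  by move=> Y _ DX _ DY; apply: addC_sum.
by move=> Y _ DY; apply: addC_summand.
Qed.

Lemma br_zero T n X : zero_mod X -> br T n X.
Proof. by case: n => [//|n] X0; apply: addC_zero. Qed.

Lemma br_summand T n X Y : br T n Y -> summand X Y -> br T n X.
Proof.
case: n => [Y0 [i [p pi]] x|n]; last exact: addC_summand.
by rewrite -[x]pi (Y0 (i x)) linear0.
Qed.

Lemma br_dsum T n X Y : br T n X -> br T n Y -> br T n (dsum X Y).
Proof.
case: n => [X0 Y0 [x y]|n]; last exact: addC_sum.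
by rewrite (X0 x) (Y0 y).
Qed.

Lemma br_extension T n X Y Z (f : {linear X -> Y}) (g : {linear Y -> Z}) :
  short_exact f g -> br1 T X -> br T n Z -> br T n.+1 Y.
Proof. by move=> ex TX TZ; apply: addC_obj; exists X, Z, f, g. Qed.

Lemma br1_br T n X : br1 T X -> br T n.+1 X.
Proof.
move=> TX; have [i iE] := @linear_of S X X id (fun _ _ _ => erefl).
have [z zE] := ex_zero_map X (zero_module S).
apply: (@br_extension T n X X (zero_module S) i z) => //.
  split; first by move=> x y; rewrite !iE.
  split=> [y|y]; first by exists 0; rewrite zE [RHS]zero_moduleP.
  by rewrite zE; split=> // _; exists y; rewrite iE.
by apply: br_zero; apply: zero_moduleP.
Qed.

Lemma br1_refl T : br1 T T.
Proof.
apply: addC_obj; have [i iE] := @linear_of S T T id (fun _ _ _ => erefl).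
by exists i, id => x; rewrite iE.
Qed.

Lemma br1_trans T U X : br1 U T -> br1 T X -> br1 U X.
Proof.
move=> UT; apply: addC_bind => Y /mod_iso_summand; exact: addC_summand.
Qed.

Lemma br_mono T U n X : br1 U T -> br T n X -> br U n X.
Proof.
move=> UT; elim: n X => [//|n IHn] X; apply: addC_bind => Y [T1 [T2 [f [g [TT1 [TT2 ex]]]]]].
apply: (br_extension ex); [exact: br1_trans UT TT1 | exact: IHn].
Qed.

Lemma br1_inl T U : br1 (dsum T U) T.
Proof. by apply: addC_summand (br1_refl _) _; apply: summand_inl. Qed.

Lemma br1_inr T U : br1 (dsum T U) U.
Proof. by apply: addC_summand (br1_refl _) _; apply: summand_inr. Qed.

(** The injective term is kept in [add U], and the cosyzygy in a class [D] of its own, so that an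
    induction can follow the layer of the cosyzygy while [U] is fixed. *)
Definition has_cosyzygy_in U (D : subcat S) K : Prop :=
  exists J C (f : {linear K -> J}) (g : {linear J -> C}),
    [/\ injective_module J, br1 U J, short_exact f g & D C].

(** Embed [K] in the injective module of [Y]. By [cosyzygy_summand] the new cokernel is a summand of
    the old one plus [J]; the index [n.+1] ensures that [J] belongs to the class. *)
Lemma has_cosyzygy_summand U n K Y :
  has_cosyzygy_in U (br U n.+1) Y -> summand K Y -> has_cosyzygy_in U (br U n.+1) K.
Proof.
move=> [J [C [f [g [iJ UJ ex UC]]]]] KY; case: (KY) => a [b ab].
have finj : injective (f \o a) by apply: inj_comp (proj1 ex) (can_inj ab).
have [C' [g' ex']] := ex_cokernel finj.
exists J, C', (f \o a), g'; split=> //.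
apply: br_summand (cosyzygy_summand iJ iJ ex' ex KY).
by apply: br_dsum => //; apply: br1_br.
Qed.

Lemma has_cosyzygy_addC U n (D : subcat S) K :
  (forall Y, D Y -> has_cosyzygy_in U (br U n.+1) Y) ->
  addC D K -> has_cosyzygy_in U (br U n.+1) K.
Proof.
move=> DU; elim=> {}K.
- move=> K0; have [f fE] := ex_zero_map K (zero_module S).
  have [|C [g ex]] := @ex_cokernel K (zero_module S) f.
    by move=> x y _; rewrite (K0 x) (K0 y).
  exists (zero_module S), C, f, g; split=> //.
  + by apply: injective_module_zero; apply: zero_moduleP.
  + by apply: addC_zero; apply: zero_moduleP.
  apply: br_zero => c; have [y <-] := proj1 (proj2 ex) c.
  by rewrite (zero_moduleP y) linear0.
- exact: DU.
- move=> Y _ [J1 [C1 [f1 [g1 [iJ1 UJ1 ex1 UC1]]]]] _ [J2 [C2 [f2 [g2 [iJ2 UJ2 ex2 UC2]]]]].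
  have [|f fE] := @linear_of S (dsum K Y) (dsum J1 J2) (fun w => (f1 w.1, f2 w.2)).
    by move=> a x y; rewrite /= !linearP.
  have [|g gE] := @linear_of S (dsum J1 J2) (dsum C1 C2) (fun w => (g1 w.1, g2 w.2)).
    by move=> a x y; rewrite /= !linearP.
  exists (dsum J1 J2), (dsum C1 C2), f, g; split.
  + exact: injective_module_dsum.
  + exact: addC_sum.
  + case: ex1 ex2 => f1inj [g1surj exg1] [f2inj [g2surj exg2]]; split; last split.
    * by move=> [x y] [x' y']; rewrite !fE => -[/f1inj -> /f2inj ->].
    * move=> [c d]; have [x <-] := g1surj c; have [y <-] := g2surj d.
      by exists (x, y); rewrite gE.
    * move=> [x y]; rewrite gE; split=> [[/exg1 [k <-] /exg2 [l <-]]|[[k l]]].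
        by exists (k, l); rewrite fE.
      rewrite fE => -[<- <-]; congr pair => /=; first by apply/exg1; exists k.
      by apply/exg2; exists l.
  exact: br_dsum.
- by move=> Y _ UY; apply: has_cosyzygy_summand.
Qed.

End Extensions.

(** * Extension dimension *)

Section Cosyzygies.
Variable S : pzRingType.
Implicit Types X Y J C K T U : lmodType S.

(** When the quotient [T2] is zero, [f] is onto, hence invertible. *)
Lemma br1_of_br T X : br T 1 X -> br1 T X.
Proof.
apply: addC_bind => Y [T1 [T2 [f [g [TT1 [T20 [finj [_ ex]]]]]]]].
apply: (addC_summand TT1).
have [||a y x y' x' <- <-|h hE] := @linear_of_rel S Y T1 (fun y x => f x = y).
- by move=> y; apply/ex; apply: T20.
- by move=> x; rewrite -(linear0 f) => /finj.
- by rewrite linearP.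
by exists h, f => y; apply/hE.
Qed.

(** The module [dsum J C] holds both the injective term and the cosyzygy of [T]. The horseshoe lemma
    carries this through each extension, so the cosyzygy of [K] needs no more layers than [K]. *)
Lemma br_cosyzygy T J C (i : {linear T -> J}) (q : {linear J -> C}) n K :
  injective_module J -> short_exact i q -> br T n K ->
  has_cosyzygy_in (dsum J C) (br (dsum J C) n) K.
Proof.
move=> iJ ex; set U := dsum J C.
have cosT K1 : br1 T K1 -> has_cosyzygy_in U (br U 1) K1.
  apply: has_cosyzygy_addC => Y /mod_iso_summand YT.
  apply: has_cosyzygy_summand YT; exists J, C, i, q; split=> //; first exact: br1_inl.
  by apply: br1_br; apply: br1_inr.
elim: n K => [|n IHn] K.
  move=> K0; have [f fE] := ex_zero_map K (zero_module S).
  have [g gE] := ex_zero_map (zero_module S) (zero_module S).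
  exists (zero_module S), (zero_module S), f, g; split.
  - by apply: injective_module_zero; apply: zero_moduleP.
  - by apply: addC_zero; apply: zero_moduleP.
  - split; first by move=> x y _; rewrite (K0 x) (K0 y).
    split=> y; first by exists 0; rewrite (zero_moduleP y) (zero_moduleP (g 0)).
    by split=> _; [exists 0 | ]; apply: etrans (zero_moduleP _) (esym (zero_moduleP _)).
  by move=> x; apply: zero_moduleP.
apply: has_cosyzygy_addC => Y [T1 [T2 [f [g [TT1 [TT2 exY]]]]]].
have [J1 [C1 [i1 [q1 [iJ1 UJ1 ex1 UC1]]]]] := cosT T1 TT1.
have [J2 [C2 [i2 [q2 [iJ2 UJ2 ex2 UC2]]]]] := IHn T2 TT2.
have [C' [i' [q' [a [b [ex' exC]]]]]] := horseshoe iJ1 exY ex1 ex2.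
exists (dsum J1 J2), C', i', q'; split=> //.
- exact: injective_module_dsum.
- exact: addC_sum.
exact: br_extension exC (br1_of_br UC1) UC2.
Qed.

Lemma ex_free_cover X : fin_gen X ->
  exists (P : lmodType S) (g : {linear P -> X}),
  [/\ projective P, br1 (S^o : lmodType S) P & forall x, exists p, g p = x].
Proof.
move=> /fin_genP [s sP].
(* Covering only the span of the list makes induction on the list possible. *)
suff [P [g [pP rP gP]]] : exists (P : lmodType S) (g : {linear P -> X}),
    [/\ projective P, br1 (S^o : lmodType S) P &
      forall x, lin_span s x -> exists p, g p = x].
  by exists P, g; split=> // x; apply: gP.
elim: s {sP} => [|y s [P [g [pP rP gP]]]].
  have [g gE] := ex_zero_map (zero_module S) X.
  exists (zero_module S), g; split.
  - by apply: projective_zero; apply: zero_moduleP.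
  - by apply: addC_zero; apply: zero_moduleP.
  by move=> x ->; exists 0; rewrite gE.
have [|f fE] := @linear_of S (S^o : lmodType S) X (fun a : S => a *: y).
  by move=> a b c; rewrite scalerDl scalerA.
have [h hE] := ex_copair f g; exists (dsum (S^o : lmodType S) P), h; split.
- by apply: projective_dsum => //; apply: projective_regular.
- by apply: addC_sum => //; apply: br1_refl.
move=> x /= [r /gP [p gp]]; exists (r, p).
by rewrite hE fE gp /= addrC subrK.
Qed.

(** Induction on the length bound: in a nontrivial decomposition both factors embed properly in [X],
    so their bounds drop. *)
Lemma br1_of_indecomposables T n X : mod_length_le X n ->
  (forall Y, summand Y X -> indecomposable Y -> br1 T Y) -> br1 T X.
Proof.
elim: n X => [|n IHn] X lX indT.
  have [X0|nX0] := pselect (zero_mod X); first exact: addC_zero.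
  (* A nonzero [X] contains the zero module properly, so its length bound is positive. *)
  have [f fE] := ex_zero_map (zero_module S) X.
  have [|ns|//] := @mod_length_le_proper S (zero_module S) X f 0 _ _ lX.
    by move=> x y _; rewrite (zero_moduleP x) (zero_moduleP y).
  by apply: nX0 => x; have [y <-] := ns x; rewrite fE.
have [X0|nX0] := pselect (zero_mod X); first exact: addC_zero.
have [Xind|] := pselect (indecomposable X); first exact/indT/Xind/summand_refl.
move=> nind.
have [Y1 [Y2 [iso [nY1 nY2]]]] : exists Y1 Y2 : lmodType S,
    mod_iso X (dsum Y1 Y2) /\ ~ zero_mod Y1 /\ ~ zero_mod Y2.
  apply: contrapT => none; apply: nind; split=> // Y1 Y2 iso.
  apply: contrapT => /not_orP [nY1 nY2]; apply: none.
  by exists Y1, Y2.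
have [h [h' hK h'K]] := mod_iso_inv iso.
have hinj : injective h := can_inj hK.
have XY := mod_iso_summand iso.
have YX := mod_iso_summand (mod_iso_inv iso).
apply: (addC_summand _ XY); apply: addC_sum; apply: IHn.
- have [l lE] := ex_inl Y1 Y2.
  have [||_ //] := mod_length_le_proper (f := h \o l) _ _ lX.
    by move=> x y /hinj; rewrite !lE => -[].
  move=> surj; apply: nY2 => y; have [x /hinj] := surj (h (0, y)).
  by rewrite lE => -[_ <-].
- by move=> Y YY1; apply/indT/(summand_trans YY1)/(summand_trans _ YX)/summand_inl.
- have [r rE] := ex_inr Y1 Y2.
  have [||_ //] := mod_length_le_proper (f := h \o r) _ _ lX.
    by move=> x y /hinj; rewrite !rE => -[].
  move=> surj; apply: nY1 => y; have [x /hinj] := surj (h (y, 0)).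
  by rewrite rE => -[<- _].
by move=> Y YY2; apply/indT/(summand_trans YY2)/(summand_trans _ YX)/summand_inr.
Qed.

(** [T] is the sum of those [F i] that are finitely generated, since [rep_finite] lets the list
    contain others. *)
Lemma ex_common_sum (I : eqType) (F : I -> lmodType S) (s : seq I) :
  exists T, fin_gen T /\ forall i, i \in s -> fin_gen (F i) -> summand (F i) T.
Proof.
elim: s => [|j s [T [fT sT]]].
  by exists (zero_module S); split=> //; apply/zero_mod_fin_gen/zero_moduleP.
have [fj|nfj] := pselect (fin_gen (F j)); last first.
  exists T; split=> // i; rewrite inE => /orP [/eqP -> //|]; exact: sT.
exists (dsum (F j) T); split; first exact: fin_gen_dsum.
move=> i; rewrite inE => /orP [/eqP -> _|si fi]; first exact: summand_inl.
exact: summand_trans (sT i si fi) (summand_inr _ _).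
Qed.

Lemma fin_gen_summand X Y : summand X Y -> fin_gen Y -> fin_gen X.
Proof. by move=> [i [p pi]]; apply: fin_gen_surj => x; exists (i x). Qed.

Lemma Omega_fin_gen i X : Omega i X -> fin_gen X.
Proof. by case: i => [|i] // []. Qed.

End Cosyzygies.

(** * Extension dimension along syzygies *)

Section ExtensionDimension.
Variables (R : comNzRingType) (A : algType R).
Hypothesis artA : artin_algebra A.

Definition ext_dim_le (C : subcat A) (d : nat) : Prop :=
  exists T : lmodType A, fin_gen T /\ subcat_le C (br T d.+1).

Lemma rep_finite_ext_dim (C : subcat A) :
  (forall X, C X -> fin_gen X) -> rep_finite C -> ext_dim_le C 0.
Proof.
move=> Cfin [m [F FP]]; have [T [fT sT]] := ex_common_sum F (enum 'I_m).
exists T; split=> // X CX; apply: br1_br.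
have fX := Cfin X CX; have [n lX] := fin_gen_mod_length artA fX.
apply: br1_of_indecomposables lX _ => Y YX indY.
have [i YF] := FP Y X CX YX indY.
apply: (addC_summand (br1_refl T)).
apply: (summand_trans (mod_iso_summand YF)); apply: sT; first by rewrite mem_enum.
(* [F i] is finitely generated because it is isomorphic to the summand [Y] of [X]. *)
apply: fin_gen_summand (fin_gen_summand YX fX).
exact: mod_iso_summand (mod_iso_inv YF).
Qed.

Lemma ext_dim_Omega_step i d :
  ext_dim_le (Omega (A := A) i.+1) d -> ext_dim_le (Omega (A := A) i) d.+1.
Proof.
move=> [T [fT OT]].
have [J [e [einj iJ fJ]]] := fin_gen_injective_envelope artA fT.
have [C [q ex]] := ex_cokernel einj.
have fC : fin_gen C := fin_gen_surj (proj1 (proj2 ex)) fJ.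
(* The summand [A] accounts for the free covers, and [dsum J C] for the cosyzygies of the
   kernels. *)
exists (dsum (A^o : lmodType A) (dsum J C)); split.
  by apply: fin_gen_dsum; [exact: regular_fin_gen | exact: fin_gen_dsum].
move=> X OX; have [P [g [pP rP gsurj]]] := ex_free_cover (Omega_fin_gen OX).
have [|K [k [kinj kP]]] := @ex_submodule A P (fun p => g p = 0).
  split; first by rewrite linear0.
  by move=> a x y gx gy; rewrite linearP gx gy scaler0 addr0.
have exX : short_exact k g by [].
(* The kernel is finitely generated because [P] has finite length. *)
have fK : fin_gen K.
  have [n lP] := fin_gen_mod_length artA (proj1 pP).
  exact: mod_length_fin_gen (mod_length_le_inj kinj lP).
have OK : Omega i.+1 K by split=> //; exists P, X, k, g.
have [J' [C' [k' [q' [iJ' _ ex' UC']]]]] := br_cosyzygy iJ ex (OT K OK).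
have [f' [g' exE]] := pushout_extension iJ' exX ex'.
(* It suffices to treat [dsum X J'], an extension of [C'] by the free module [P]; this costs one
   layer more than [C']. *)
apply: br_summand (summand_inl X J').
apply: (br_extension exE); first exact: br1_trans (br1_inl _ _) rP.
exact: br_mono (br1_inr _ _) UC'.
Qed.

Lemma ext_dim_Omega i j d :
  ext_dim_le (Omega (A := A) (i + j)) d -> ext_dim_le (Omega (A := A) i) (d + j).
Proof.
elim: j d => [|j IHj] d; first by rewrite !addn0.
by rewrite !addnS -addSn => /ext_dim_Omega_step /IHj.
Qed.

End ExtensionDimension.

Theorem theorem2p17 (R : comNzRingType) (A : algType R) (n : nat) :
  artin_algebra A ->
  @syzygy_finite A n ->
  ext_dim_eq (@modcat A) n ->
  forall i : nat, (i <= n)%N -> ext_dim_eq (@Omega A i) (n - i).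
Proof.
move=> artA synA [_ edA] i le_in; split.
  (* Start from [Omega^n], of dimension 0, and descend [n - i] syzygy steps, each adding at most
     1. *)
  rewrite -[(n - i)%N]add0n; apply: (ext_dim_Omega artA); rewrite subnKC //.
  by apply: rep_finite_ext_dim => // X; apply: Omega_fin_gen.
(* A bound [m < n - i] for [Omega^i] would give the bound [m + i < n] for [Omega^0], which is
   [A-mod]. *)
move=> m lt_m edO; apply: (edA (m + i)%N); first by rewrite addnC -ltn_subRL.
by apply: (@ext_dim_Omega R A artA 0 i m).
Qed.
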